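(* Let $\mathcal{M}=(m_1:m_2:m_3)$, $\gcd(m_1,m_2,m_3)=1$, be a transversal birational map of $\mathbb{P}^2(\mathbb{K})$. Then $\mathcal{L}(\mathcal{M})=\Lambda(\mathcal{M})$, where $\mathcal{L}(\mathcal{M})$ is the linear span of the components of $\mathcal{M}$ and $\Lambda(\mathcal{M})$ is the linear system of base points of $\mathcal{M}$.
   Context: $\mathbb{K}$ is an algebraically closed field of characteristic zero, $\overline{t}=(t_1,t_2,t_3)$. For a birational map $\mathcal{M}=(m_1:m_2:m_3)$ of $\mathbb{P}^2(\mathbb{K})$ with $m_i\in\mathbb{K}[\overline t]$ homogeneous of the same degree and $\gcd(m_1,m_2,m_3)=1$, $\deg(\mathcal{M})$ is the common degree of the $m_i$. For a form $f$, $C(f)$ is the plane curve it defines over the algebraic closure of its coefficient field (multiple components allowed), $\mathrm{mult}(A,C(f))$ is its multiplicity at $A$, and $\mathrm{mult}_A(C(f),C(g))$ is the intersection multiplicity at $A$. The base locus is $\mathrm{B}(\mathcal{M})=\{A\in\mathbb{P}^2(\mathbb{K}):m_1(A)=m_2(A)=m_3(A)=0\}$. Put $V_1=\sum_{i=1}^3x_im_i$, $V_2=\sum_{i=1}^3y_im_i$ with new variables $x_i,y_i$, regarded as forms in $\overline t$ over the algebraic closure of the field of rational functions in the $x_i,y_i$. For $A\in\mathrm{B}(\mathcal{M})$, $\mathrm{mult}(A,\mathrm{B}(\mathcal{M})):=\mathrm{mult}_A(C(V_1),C(V_2))$. $\mathcal{M}$ is transversal if $\mathrm{B}(\mathcal{M})=\emptyset$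 or $\mathrm{mult}(A,\mathrm{B}(\mathcal{M}))=\mathrm{mult}(A,C(V_1))^2$ for every $A\in\mathrm{B}(\mathcal{M})$. Forms of degree $d$ in $\mathbb{K}[\overline t]$ up to nonzero scalars form the projective space $\mathbb{V}_d=\mathbb{P}^{d(d+3)/2}(\mathbb{K})$. Inside $\mathbb{V}_{\deg(\mathcal{M})}$ define $$\mathcal{L}(\mathcal{M})=\{a_1m_1+a_2m_2+a_3m_3 : (a_1:a_2:a_3)\in\mathbb{P}^2(\mathbb{K})\},$$ $$\Lambda(\mathcal{M})=\{f\in\mathbb{V}_{\deg(\mathcal{M})} : \mathrm{mult}(A,C(f))\ge\sqrt{\mathrm{mult}(A,\mathrm{B}(\mathcal{M}))}\ \text{ for all } A\in\mathrm{B}(\mathcal{M})\}.$$ *)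

(* Defs.v *)
From HB Require Import structures.
From mathcomp Require Import all_boot all_order all_algebra all_field.
From mathcomp Require Import fraction mpoly.

Set Implicit Arguments.
Unset Strict Implicit.
Unset Printing Implicit Defensive.

Import GRing.Theory Num.Theory.
Local Open Scope ring_scope.

Local Notation "x %:F" := (tofrac x) : ring_scope.

Record alg_closure (k : fieldType) := AlgClosure {
  ac_field :> closedFieldType;
  ac_emb : {rmorphism k -> ac_field};
  ac_algebraic : forall z : ac_field, algebraicOver ac_emb z
}.

(** Points of P^2 are given by homogeneous coordinates [A : 'I_3 -> k], not all
    zero. Every notion below is invariant under rescaling [A]. *)

Definition proj_point (k : fieldType) (A : 'I_3 -> k) : Prop :=
  exists i, A i != 0.

Section PlaneCurves.
Variable k : fieldType.
Implicit Types (A : 'I_3 -> k) (f g p q l : {mpoly k[3]}).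

(** The largest [r] such that all partial derivatives of [f] of order [< r]
    vanish at [A]. This is the multiplicity of [A] on the curve [f = 0] when [f]
    is a nonzero form and [k] has characteristic zero. *)
Definition mult A f : nat :=
  \max_(r < msize f | [forall m : 'X_{1..3 < r}, (f^`M[m]).@[A] == 0]) r.

(** The local ring of P^2 at [A], inside the fraction field of [k[t1, t2, t3]]. *)
Definition local_ring A (r : {fraction {mpoly k[3]}}) : Prop :=
  exists e p q, [/\ p \is e.-homog, q \is e.-homog, q.@[A] != 0
                  & r = p%:F / q%:F].

(** [dehomog f l] is [f / l ^ deg f]; recall [msize f = deg f + 1]. *)
Definition dehomog f l : {fraction {mpoly k[3]}} :=
  f%:F / (l ^+ (msize f).-1)%:F.

(** The ideal generated by the forms [f] and [g] in the local ring at [A]; it does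
    not depend on the linear form [l] used to dehomogenize. *)
Definition local_ideal A f g (r : {fraction {mpoly k[3]}}) : Prop :=
  exists l u v, [/\ l \is 1.-homog, l.@[A] != 0,
    local_ring A u, local_ring A v
    & r = u * dehomog f l + v * dehomog g l].

(** [is_inter_mult A f g n]: the quotient of the local ring at [A] by [(f, g)] has
    [k]-dimension [n], i.e. it has a basis [e] of size [n]. No [n] qualifies when
    the dimension is infinite. *)
Definition is_inter_mult A f g (n : nat) : Prop :=
  exists e : 'I_n -> {fraction {mpoly k[3]}},
    (forall i, local_ring A (e i)) /\
    (forall r, local_ring A r ->
       exists! c : 'rV[k]_n,
         local_ideal A f g (r - \sum_(i < n) ((c 0 i)%:MP)%:F * e i)).

(** [proj_space d f]: the form [f] represents a point of the projective space of
    forms of degree [d] up to nonzero scalars. *)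
Definition proj_space (d : nat) f : Prop := f != 0 /\ f \is d.-homog.

End PlaneCurves.

Section RationalMaps.
Variable K : fieldType.
Implicit Types (M N : 3.-tuple {mpoly K[3]}) (A : 'I_3 -> K).

Definition homog_map (d : nat) M : Prop := forall i, tnth M i \is d.-homog.

Definition nonzero_map M : Prop := exists i, tnth M i != 0.

Definition gcd_one M : Prop :=
  forall p : {mpoly K[3]},
    (forall i, exists q, tnth M i = q * p) -> p \is a GRing.unit.

Definition comp_map M N : 3.-tuple {mpoly K[3]} :=
  [tuple tnth M i \mPo N | i < 3].

Definition id_map : 3.-tuple {mpoly K[3]} := [tuple 'X_i | i < 3].

(** Equality [(M1 : M2 : M3) = (N1 : N2 : N3)] of rational maps. *)
Definition eq_map M N : Prop :=
  [/\ nonzero_map M, nonzero_map N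
    & forall i j, tnth M i * tnth N j = tnth M j * tnth N i].

Definition birational M : Prop :=
  exists d N, [/\ homog_map d N, eq_map (comp_map N M) id_map
                & eq_map (comp_map M N) id_map].

Definition base_locus M A : Prop :=
  proj_point A /\ forall i, (tnth M i).@[A] = 0.

(** The variables [x_i] are ['X_(lshift 3 i)], the [y_i] are ['X_(rshift 3 i)]. *)
Variable F : alg_closure {fraction {mpoly K[3 + 3]}}.

Definition coefF (P : {mpoly K[3 + 3]}) : F := ac_emb F P%:F.

Definition pointF A : 'I_3 -> F := fun i => coefF (A i)%:MP.

Definition formF (f : {mpoly K[3]}) : {mpoly F[3]} :=
  map_mpoly (fun c : K => coefF c%:MP) f.

Definition V1 M : {mpoly F[3]} :=
  \sum_(i < 3) coefF 'X_(lshift 3 i) *: formF (tnth M i).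

Definition V2 M : {mpoly F[3]} :=
  \sum_(i < 3) coefF 'X_(rshift 3 i) *: formF (tnth M i).

Definition is_base_mult M A (n : nat) : Prop :=
  is_inter_mult (pointF A) (V1 M) (V2 M) n.

Definition transversal_map M : Prop :=
  forall A, base_locus M A -> is_base_mult M A (mult (pointF A) (V1 M) ^ 2)%N.

(** [calL M] and [Lambda d M] are sets of forms closed under nonzero scaling; they
    stand for the corresponding subsets of the projective space of forms. *)
Definition calL M (f : {mpoly K[3]}) : Prop :=
  exists a : 'I_3 -> K, proj_point a /\ f = \sum_(i < 3) a i *: tnth M i.

(** The square root and the comparison are taken in the algebraic numbers. *)
Definition Lambda (d : nat) M (f : {mpoly K[3]}) : Prop :=
  proj_space d f /\
  forall A, base_locus M A ->
    exists2 n, is_base_mult M A n & sqrtC (n%:R : algC) <= (mult A f)%:R.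

End RationalMaps.

(* Main.v *)
(** Let [N] be an inverse of [M], so that [m_j(N) = h t_j] and [N(M) = g t]. The inclusion of
    [L(M)] in [Lambda(M)] compares derivatives. For the converse it suffices that [h] divides
    [f(N)] for [f] in [Lambda(M)]: then [f(N) = h l] with [l] a linear form, and composing with
    [M] gives [g^d f = g^d l(m_1, m_2, m_3)].

    The divisibility is tested on lines [b + s a]. There [N] becomes an arc with values in the
    plane, after division by its content, and every root of what is left of [h] is a parameter
    at which the arc meets a base point [A]. If [r] is the multiplicity of [V_1] at [A] and [mu]
    the order of the arc at [A], then [f] vanishes along the arc to order at least [r mu], so it
    suffices that some [m_j] vanishes to order at most [r mu]. This is where transversality
    enters: the jets of order [2 r] at [A] form a space of dimension [r^2 + 2 (r (r + 1) / 2)],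
    so an intersection multiplicity equal to [r^2] forces the multiples of [V_1] and [V_2] by
    the monomials of degree less than [r] to be independent there. Hence the Sylvester matrix of
    the two tangent cones is invertible, and every monomial of degree [2 r - 1] in the local
    coordinates is, up to higher order, in the ideal [m^(r - 1) (m_1, m_2, m_3)], where [m] is
    the maximal ideal. *)

Require Import Defs.
From HB Require Import structures.
From mathcomp Require Import all_boot all_order all_algebra all_field.
From mathcomp Require Import fraction mpoly.
From mathcomp Require Import zify ring.
From Stdlib Require Import Classical_Prop.

Set Implicit Arguments.
Unset Strict Implicit.
Unset Printing Implicit Defensive.

Import GRing.Theory Num.Theory.
Local Open Scope ring_scope.

(** * Substitution, order at the origin and affine charts *)

Section Substitution.
Variables (K : comNzRingType) (n : nat).
Implicit Types (p : {mpoly K[n]}).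

Lemma eq_mmap (R : comNzRingType) (s : {rmorphism K -> R}) (x y : 'I_n -> R) p :
  x =1 y -> mmap s x p = mmap s y p.
Proof.
by move=> xy; apply: eq_bigr => m _; congr (_ * _); apply: eq_bigr => i _; rewrite xy.
Qed.

Lemma rmorph_mmap (R S : comNzRingType) (g : {rmorphism R -> S})
    (s : {rmorphism K -> R}) (x : 'I_n -> R) p :
  g (mmap s x p) = mmap (g \o s) (g \o x) p.
Proof.
rewrite rmorph_sum; apply: eq_bigr => m _; rewrite rmorphM rmorph_prod.
by congr (_ * _); apply: eq_bigr => i _; rewrite rmorphXn.
Qed.

Lemma mmap_comp_mpoly (R : comNzRingType) (k : nat) (s : {rmorphism K -> R})
    (x : 'I_k -> R) (lq : n.-tuple {mpoly K[k]}) p :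
  mmap s x (p \mPo lq) = mmap s (fun i => mmap s x (tnth lq i)) p.
Proof.
rewrite rmorph_mmap; apply: eq_bigr => m _; congr (_ * _).
by rewrite /= mmapC.
Qed.

Lemma mmap_homog_scale (R : comNzRingType) (s : {rmorphism K -> R})
    (u : R) (x : 'I_n -> R) (d : nat) p :
  p \is d.-homog -> mmap s (fun i => u * x i) p = u ^+ d * mmap s x p.
Proof.
move/dhomogP => hp; rewrite /mmap big_distrr /= [LHS]big_seq [RHS]big_seq.
apply: eq_bigr => m /hp /= <-; rewrite mulrCA; congr (_ * _).
rewrite /mmap1 mdegE -prodrXr -big_split /=.
by apply: eq_bigr => i _; rewrite exprMn.
Qed.

Lemma dhomog_comp_mpoly (k d e : nat) (lq : n.-tuple {mpoly K[k]}) p :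
  p \is d.-homog -> (forall i, tnth lq i \is e.-homog) ->
  p \mPo lq \is (d * e).-homog.
Proof.
move=> /dhomogP hp hq; rewrite comp_mpolyE big_seq; apply: rpred_sum => m /hp /= <-.
apply: dhomogZ; rewrite mdegE big_distrl /=.
apply: (big_rec2 (fun (y1 : nat) (y2 : {mpoly K[k]}) => y2 \is y1.-homog)).
  exact: dhomog1.
move=> i y1 y2 _ hy; apply: dhomogM hy; rewrite mulnC; exact: dhomogMn.
Qed.

End Substitution.

(** Substitutions and derivations only have to be compared on constants and variables. *)
Lemma mpoly_alg_ind (n : nat) (K : comNzRingType) (P : {mpoly K[n]} -> Prop) :
  (forall c, P c%:MP) -> (forall i, P 'X_i) ->
  (forall p q, P p -> P q -> P (p + q)) -> (forall p q, P p -> P q -> P (p * q)) ->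
  forall p, P p.
Proof.
move=> PC PX PD PM; have PXm m : P 'X_[m].
  rewrite mpolyXE_id; elim/big_rec: _ => [|j q _ hq]; first exact: (PC 1).
  apply: (PM) => //; elim: (m j) => [|x ih]; first exact: (PC 1).
  by rewrite exprS; apply: PM.
elim/mpolyind => [|c m p _ _ ih]; first by rewrite -mpolyC0.
by apply: (PD) => //; rewrite -mul_mpolyC; apply: (PM).
Qed.

Section Order.
Variables (n : nat) (K : comNzRingType).
Implicit Types (p q : {mpoly K[n]}).

(** Membership in the [N]-th power of the ideal of the origin. *)
Definition ord_ge (N : nat) p := forall m, (mdeg m < N)%N -> p@_m = 0.

Lemma ord_ge0 N : ord_ge N 0.
Proof. by move=> m _; rewrite mcoeff0. Qed.

Lemma ord_geD N p q : ord_ge N p -> ord_ge N q -> ord_ge N (p + q).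
Proof. by move=> hp hq m hm; rewrite mcoeffD hp ?hq ?addr0. Qed.

Lemma ord_geN N p : ord_ge N p -> ord_ge N (- p).
Proof. by move=> hp m hm; rewrite mcoeffN hp ?oppr0. Qed.

Lemma ord_geB N p q : ord_ge N p -> ord_ge N q -> ord_ge N (p - q).
Proof. by move=> hp hq; apply: ord_geD hp _; apply: ord_geN. Qed.

Lemma ord_geZ N c p : ord_ge N p -> ord_ge N (c *: p).
Proof. by move=> hp m hm; rewrite mcoeffZ hp ?mulr0. Qed.

Lemma ord_ge_sum N (I : Type) (r : seq I) (P : pred I) (F : I -> {mpoly K[n]}) :
  (forall i, P i -> ord_ge N (F i)) -> ord_ge N (\sum_(i <- r | P i) F i).
Proof.
by move=> hF; elim/big_rec: _ => [|i p Pi hp]; [apply: ord_ge0 | apply: ord_geD => //; apply: hF].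
Qed.

Lemma ord_geM N1 N2 p q : ord_ge N1 p -> ord_ge N2 q -> ord_ge (N1 + N2) (p * q).
Proof.
move=> hp hq m hm; rewrite (mcoeff_poly_mul _ _ (leqnn _)) big1 // => -[m1 m2] /eqP /= em.
case: (ltnP (mdeg m1) N1) => [/hp ->|h1]; first by rewrite mul0r.
rewrite hq ?mulr0 //; rewrite em mdegD in hm; lia.
Qed.

Lemma ord_ge_mull N p q : ord_ge N q -> ord_ge N (p * q).
Proof. by move=> hq; rewrite -[N]add0n; apply: ord_geM. Qed.

Lemma ord_geX N p k : ord_ge N p -> ord_ge (k * N) (p ^+ k).
Proof.
move=> hp; elim: k => [|k ih]; first by [].
by rewrite exprS mulSn; apply: ord_geM.
Qed.

Lemma ord_ge_mpolyX m : ord_ge (mdeg m) 'X_[m].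
Proof.
by move=> m' hm; rewrite mcoeffX; case: eqP hm => // ->; rewrite ltnn.
Qed.

Lemma ord_ge1 p : p@_0 = 0 -> ord_ge 1 p.
Proof. by move=> p0 m; rewrite ltnS leqn0 mdeg_eq0 => /eqP ->. Qed.

End Order.

Lemma ord_ge_inv (n : nat) (K : fieldType) (q : {mpoly K[n]}) (N : nat) :
  q@_0 != 0 -> exists i, ord_ge N (i * q - 1).
Proof.
(* Since [q / q(0) = 1 - y] with [y] of order at least 1, a truncated geometric series inverts
   it. *)
move=> q0; pose y := 1 - (q@_0)^-1 *: q.
exists ((\sum_(i < N) y ^+ i) * ((q@_0)^-1)%:MP).
rewrite -mulrA mul_mpolyC; have -> : (q@_0)^-1 *: q = 1 - y by rewrite /y opprB addrC subrK.
rewrite mulrC -(opprB y 1) mulNr -subrX1 opprB addrAC subrr add0r; apply: ord_geN.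
rewrite -[N in ord_ge N]muln1; apply: ord_geX; apply: ord_ge1.
by rewrite mcoeffB mcoeff1 eqxx mcoeffZ mulVf // subrr.
Qed.

Section Chart.
Variables (K : comNzRingType) (n : nat) (k : 'I_n.+1) (A : 'I_n.+1 -> K).
Implicit Types (p : {mpoly K[n.+1]}).

(** Affine coordinates centred at [A] in the chart [t_k = A_k]. *)
Definition chart_var (i : 'I_n.+1) : {mpoly K[n]} :=
  (A i)%:MP + oapp (fun j => 'X_j) 0 (unlift k i).

Definition chart : {mpoly K[n.+1]} -> {mpoly K[n]} := mmap (@mpolyC n K) chart_var.

HB.instance Definition _ := GRing.RMorphism.on chart.

Lemma chartZ c p : chart (c *: p) = c *: chart p.
Proof. by rewrite /chart mmapZ mul_mpolyC. Qed.

Lemma mcoeff0_chart p : (chart p)@_0 = p.@[A].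
Proof.
rewrite /chart (rmorph_mmap (mcoeff 0)) /meval.
have h i : (mcoeff 0 \o chart_var) i = A i.
  rewrite /= /chart_var mcoeffD mcoeffC eqxx mulr1.
  case: (unlift k i) => [j|] /=; last by rewrite mcoeff0 addr0.
  by rewrite mcoeffX mnm1_eq0 addr0.
rewrite (eq_mmap _ _ h); apply: eq_bigr => m _.
by rewrite /= mcoeffC eqxx mulr1.
Qed.

Lemma mderiv_chart i p : (chart p)^`M(i) = chart p^`M(lift k i).
Proof.
elim/mpoly_alg_ind: p => [c|j|p q hp hq|p q hp hq]; first 1 last.
- rewrite mderivX /chart mmapX mmap1U /chart_var mderivD mderivC add0r mnm1E.
  case: unliftP => [j' ->|->] /=; last first.
    by rewrite mderiv0 (negPf (neq_lift _ _)) scale0r mmap0.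
  rewrite mderivX mnm1E (inj_eq (@lift_inj _ k)).
  case: eqP => [->|_]; last by rewrite !scale0r mmap0.
  have e m (l : 'I_m) : (U_(l) - U_(l) = 0)%MM by apply/mnmP => x; rewrite mnmBE subnn mnm0E.
  by rewrite !e !mpolyX0 !scale1r rmorph1.
- by rewrite !raddfD /= hp hq.
- by rewrite rmorphM !mderivM hp hq rmorphD !rmorphM.
- by rewrite /chart mmapC !mderivC mmap0.
Qed.

End Chart.

(** The constant term is the value at [A]. Any other coefficient, at [m] say, becomes after
    multiplication by [m i] a coefficient of lower degree of a partial derivative, and [m i] is
    invertible in characteristic zero. *)
Lemma ord_ge_chart (K : fieldType) (charK : [pchar K] =i pred0) (n : nat)
    (k : 'I_n.+1) (A : 'I_n.+1 -> K) (r : nat) (p : {mpoly K[n.+1]}) :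
  (forall m, (mdeg m < r)%N -> (p^`M[m]).@[A] = 0) -> ord_ge r (chart k A p).
Proof.
have natK_neq0 x : x.+1%:R != 0 :> K by move/pcharf0P: charK => ->.
elim: r p => [|r ih] p hp m //; rewrite ltnS => hm.
case: (altP (m =P 0%MM)) => [->|m0].
  by rewrite mcoeff0_chart -[p]mderivm0m hp ?mdeg0.
have [i mi] : exists i, m i != 0%N.
  apply/existsP; rewrite -negb_forall; apply: contra m0 => /forallP h.
  by apply/eqP/mnmP => i; rewrite mnm0E; apply/eqP.
have Ui : (U_(i) <= m)%MM by rewrite lep1mP.
have : (chart k A p)^`M(i)@_(m - U_(i)) = 0.
  rewrite mderiv_chart; apply: ih => [m' hm'|].
    by rewrite -mderivmU1m -mderivmDm hp // mdegD mdeg1.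
  move: hm; rewrite -{1}(submK Ui) mdegD mdeg1; lia.
rewrite mcoeff_mderiv submK // -mulr_natr => /eqP; rewrite mulf_eq0.
by rewrite (negPf (natK_neq0 _)) orbF => /eqP.
Qed.

(** * Arcs *)

Section Arcs.
Variables (K : fieldType) (n : nat).
Implicit Types (p : {mpoly K[n]}) (q : {poly K}) (x y : 'I_n -> {poly K}).

Lemma dvdp_mmap_sub q x y p : (forall i, q %| x i - y i) ->
  q %| mmap (@polyC K) x p - mmap (@polyC K) y p.
Proof.
move=> h; elim/mpoly_alg_ind: p => [c|i|p1 p2 h1 h2|p1 p2 h1 h2].
- by rewrite !mmapC subrr dvdp0.
- by rewrite !mmapX !mmap1U.
- by rewrite !mmapD opprD addrACA dvdp_add.
- rewrite !rmorphM /=; set a := mmap _ x p1; set b := mmap _ y p1.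
  set c := mmap _ x p2; set e := mmap _ y p2.
  have -> : a * c - b * e = (a - b) * c + b * (c - e).
    by rewrite mulrBl mulrBr addrA subrK.
  by apply: dvdp_add; [apply: dvdp_mulr | apply: dvdp_mull].
Qed.

Lemma dvdp_mmap_ord (N mu : nat) q x p : ord_ge N p ->
  (forall i, q ^+ mu %| x i) -> q ^+ (N * mu) %| mmap (@polyC K) x p.
Proof.
move=> hp hx; rewrite /mmap; elim/big_rec: _ => [|m c _ hc]; first exact: dvdp0.
apply: dvdp_add hc.
case: (ltnP (mdeg m) N) => [/hp ->|hm]; first by rewrite mul0r dvdp0.
apply/dvdp_mull/(dvdp_trans (dvdp_exp2l _ (leq_mul hm (leqnn mu)))).
rewrite mdegE big_distrl /= -prodrXr /mmap1.
elim/big_rec2: _ => [|i a b _ hab]; first exact: dvdpp.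
by apply: dvdp_mul hab; rewrite mulnC exprM; apply: dvdp_exp2r.
Qed.

End Arcs.

Lemma XsubC_exp_inv (K : fieldType) (s0 : K) (q : {poly K}) (B : nat) :
  q.[s0] != 0 -> exists i, ('X - s0%:P) ^+ B %| i * q - 1.
Proof.
move=> q0; have /Bezout_coprimepP[[u v] /= /eqpP[[a b] /= /andP[a0 b0] e]] :
    coprimep (('X - s0%:P) ^+ B) q.
  by apply: coprimep_expl; rewrite coprimep_sym coprimep_XsubC.
(* The Bezout relation holds up to the scalars [a] and [b], whence the factor [b^-1 * a]. *)
exists ((b^-1 * a)%:P * v); rewrite -mulrA mul_polyC -scalerA.
have -> : (1 : {poly K}) = b^-1 *: (b *: 1) by rewrite scalerA mulVf // scale1r.
rewrite -e -!scalerBr !dvdpZr ?invr_eq0 // opprD addrCA subrr addr0 -mulNr.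
exact: dvdp_mull.
Qed.

Lemma mup_exp (K : fieldType) (s0 : K) (q : {poly K}) (e : nat) :
  q != 0 -> mup s0 (q ^+ e) = (e * mup s0 q)%N.
Proof.
move=> q0; elim: e => [|e ih]; last by rewrite exprS mupM ?expf_neq0 // ih mulSn.
by rewrite expr0 mul0n mupNroot // root1.
Qed.

Section ArcChart.
Variables (K : fieldType) (n : nat) (k : 'I_n.+1) (A : 'I_n.+1 -> K) (s0 : K).
Variable x : 'I_n.+1 -> {poly K}.
Hypotheses (Ak : A k != 0) (xA : forall i, (x i).[s0] = A i).

(** The arc [x] in the affine coordinates of [chart k A], cleared of the denominator [x k]. *)
Definition arc_coord (j : 'I_n) : {poly K} := A k *: x (lift k j) - A (lift k j) *: x k.

(** Let [u] invert [x k] modulo a power of ['X - s0]. Scaling the arc by [A k *: u] makes its [k]-th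
    coordinate [A k] and the others [A i + u * arc_coord], modulo that power; by homogeneity the
    scaling multiplies [f] by [(A k *: u) ^+ d]. *)
Lemma arc_chart (B : nat) : exists2 u, u.[s0] != 0 &
  forall d (f : {mpoly K[n.+1]}), f \is d.-homog ->
    ('X - s0%:P) ^+ B %| (A k *: u) ^+ d * mmap (@polyC K) x f
      - mmap (@polyC K) (fun j => u * arc_coord j) (chart k A f).
Proof.
(* The exponent [B.+1] is positive even for [B = 0], so the congruence forces [u.[s0] != 0]. *)
have [u hu] := @XsubC_exp_inv K s0 (x k) B.+1 (etrans (congr1 (fun a => a != 0) (xA k)) Ak).
have u0 : u.[s0] != 0.
  apply/eqP => u0; have /dvdpP[v /(congr1 (horner^~ s0)) /eqP] := hu.
  rewrite hornerM horner_exp hornerXsubC subrr expr0n mulr0 hornerD hornerM u0 mul0r.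
  by rewrite hornerN hornerC add0r oppr_eq0 oner_eq0.
exists u => // d f hf; rewrite -(mmap_homog_scale _ _ _ hf).
have -> : mmap (@polyC K) (fun j => u * arc_coord j) (chart k A f) =
  mmap (@polyC K) (fun i => mmap (@polyC K) (fun j => u * arc_coord j) (chart_var k A i)) f.
  by rewrite /chart rmorph_mmap; apply: eq_bigr => m _; rewrite /= mmapC.
apply: dvdp_mmap_sub => i; rewrite /chart_var mmapD mmapC.
have hB : ('X - s0%:P) ^+ B %| u * x k - 1.
  by apply: dvdp_trans hu; apply: dvdp_exp2l.
case: unliftP => [j ->|->] /=.
   rewrite mmapX mmap1U /arc_coord -!mul_polyC; set i' := lift k j.
  have -> : (A k)%:P * u * x i' - ((A i')%:P + u * ((A k)%:P * x i' - (A i')%:P * x k))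
    = (A i')%:P * (u * x k - 1) by ring.
  by rewrite dvdp_mull.
rewrite mmap0 -mul_polyC.
have -> : (A k)%:P * u * x k - ((A k)%:P + 0) = (A k)%:P * (u * x k - 1) by ring.
by rewrite dvdp_mull.
Qed.

Lemma dvdp_XsubC_exp_unit (e : nat) (u q : {poly K}) : u.[s0] != 0 ->
  (('X - s0%:P) ^+ e %| u * q) = (('X - s0%:P) ^+ e %| q).
Proof.
move=> u0; apply: Gauss_dvdpr; apply: coprimep_expl.
by rewrite coprimep_sym coprimep_XsubC.
Qed.

Lemma dvdp_arc (r mu d : nat) (f : {mpoly K[n.+1]}) :
  f \is d.-homog -> ord_ge r (chart k A f) ->
  (forall j, ('X - s0%:P) ^+ mu %| arc_coord j) ->
  ('X - s0%:P) ^+ (r * mu) %| mmap (@polyC K) x f.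
Proof.
move=> hf hr hw; have [u u0 hu] := arc_chart (r * mu).
have uA : ((A k *: u) ^+ d).[s0] != 0.
  by rewrite horner_exp expf_neq0 // hornerZ mulf_neq0.
rewrite -(dvdp_XsubC_exp_unit _ _ uA).
rewrite -(subrK (mmap (@polyC K) (fun j => u * arc_coord j) (chart k A f)) (_ * _)).
apply: dvdp_add; first exact: hu.
by apply: dvdp_mmap_ord => // j; apply: dvdp_mull.
Qed.

(** The order of an arc along a form of multiplicity [r + 1] at [A] is at least [r + 1] times the order
    of the arc at [A]. Hypothesis [red] says that [(m_1, m_2, m_3)] is a reduction of the [(r + 1)]-th
    power of the maximal ideal, and then some [m_j] attains this bound. *)
Lemma exists_arc_order (I : finType) (m : I -> {mpoly K[n.+1]}) (f : {mpoly K[n.+1]})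
    (d e r : nat) :
  (forall j, m j \is d.-homog) -> f \is e.-homog ->
  (forall j, ord_ge r.+1 (chart k A (m j))) -> ord_ge r.+1 (chart k A f) ->
  forall red : (forall i : 'I_n, exists q : I -> {mpoly K[n]}, (forall j, ord_ge r (q j)) /\
    ord_ge r.+1.*2 ('X_i ^+ r.*2.+1 - \sum_j q j * chart k A (m j))),
  (exists j, mmap (@polyC K) x (m j) != 0) ->
  exists N, ('X - s0%:P) ^+ N %| mmap (@polyC K) x f /\
    exists j, ~~ (('X - s0%:P) ^+ N.+1 %| mmap (@polyC K) x (m j)).
Proof.
move=> hm hf om ohf red [j0 mj0]; set p := 'X - s0%:P.
(* If all local coordinates vanish identically, the arc stays at [A] and [m j0] vanishes along it to
   every order. *)
have [w0|] := altP (@forallP _ (fun i => arc_coord i == 0)).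
  have : p ^+ (r.+1 * (mup s0 (mmap (@polyC K) x (m j0))).+1) %| mmap (@polyC K) x (m j0).
    by apply: dvdp_arc => // j; rewrite (eqP (w0 j)) dvdp0.
  by rewrite -mup_geq // mulSn => /(leq_trans (leq_addr _ _)); rewrite ltnn.
rewrite negb_forall => /existsP[i1 wi1].
(* The order [mu] of the arc at [A] is the least order of a nonzero local coordinate, attained at
   [i0]. *)
pose i0 := [arg min_(i < i1 | arc_coord i != 0) mup s0 (arc_coord i)].
have [wi0 min_i0] : arc_coord i0 != 0 /\
    forall i, arc_coord i != 0 -> (mup s0 (arc_coord i0) <= mup s0 (arc_coord i))%N.
  by rewrite /i0; case: arg_minnP => // i wi mi; split.
have [mu emu] : exists mu, mup s0 (arc_coord i0) = mu by eexists.
have hw j : p ^+ mu %| arc_coord j.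
  have [->|wj] := eqVneq (arc_coord j) 0; first exact: dvdp0.
  by rewrite -mup_geq // -emu min_i0.
(* Positivity gives [(2r + 1) mu + 1 <= (2r + 2) mu], so the error term in [red] is negligible. *)
have mu_gt0 : (0 < mu)%N.
  by rewrite -emu -XsubC_dvd // dvdp_XsubCl /root !hornerE !xA mulrC subrr.
exists (r.+1 * mu)%N; split; first exact: dvdp_arc hf ohf hw.
(* Otherwise each [q j * m j] vanishes to order [r mu + (r + 1) mu + 1], and by [red] so does the
   power [2r + 1] of coordinate [i0], whose order is exactly [(2r + 1) mu]. *)
apply/existsP; rewrite -negb_forall; apply/negP => /forallP all_dvd.
have [u u0 hu] := arc_chart (r.+1 * mu).+1.
pose ev := mmap (@polyC K) (fun j => u * arc_coord j).
have ev_m j : p ^+ (r.+1 * mu).+1 %| ev (chart k A (m j)).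
  by have := hu _ _ (hm j); rewrite dvdp_subr // dvdp_mull //; exact: all_dvd.
have [q [hq hX]] := red i0.
have : p ^+ (r.*2.+1 * mu).+1 %| ev ('X_i0 ^+ r.*2.+1).
  rewrite -(subrK (\sum_j q j * chart k A (m j)) ('X_i0 ^+ _)) /ev rmorphD /= -/ev.
  apply: dvdp_add.
    apply: dvdp_trans (dvdp_mmap_ord hX (fun i => dvdp_mull u (hw i))).
    by apply: dvdp_exp2l; nia.
  rewrite /ev rmorph_sum; apply: (big_ind (fun a => _ %| a)); [exact: dvdp0|exact: dvdp_add|].
  move=> j _; rewrite rmorphM /=.
  have -> : (r.*2.+1 * mu).+1 = (r * mu + (r.+1 * mu).+1)%N by nia.
  rewrite exprD; apply: dvdp_mul (ev_m j).
  by apply: dvdp_mmap_ord => // i; apply: dvdp_mull.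
rewrite /ev rmorphXn /= mmapX mmap1U exprMn dvdp_XsubC_exp_unit ?horner_exp ?expf_neq0 //.
by rewrite -mup_geq ?expf_neq0 // mup_exp // emu ltnn.
Qed.

End ArcChart.

(** * Jets of order [2 r] in two variables *)

Section Jets.
Variable L : fieldType.
Implicit Types (p q a b u v : {mpoly L[2]}) (r N : nat).

Definition jet_row N p : 'rV[L]_#|{: 'X_{1..2 < N}}| :=
  \row_i p@_(enum_val i : 'X_{1..2 < N}).

Lemma jet_rowE N p (m : 'X_{1..2}) (hm : (mdeg m < N)%N) :
  jet_row N p 0 (enum_rank (BMultinom hm)) = p@_m.
Proof. by rewrite mxE enum_rankK. Qed.

Lemma jet_row_eq0 N p : jet_row N p = 0 <-> ord_ge N p.
Proof.
split=> [h m hm|h]; first by rewrite -(jet_rowE p hm) h mxE.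
by apply/rowP => i; rewrite !mxE h ?bmdeg.
Qed.

Lemma jet_row_linear N : linear (jet_row N).
Proof. by move=> c p q; apply/rowP => i; rewrite !mxE mcoeffD mcoeffZ. Qed.

HB.instance Definition _ N :=
  GRing.isLinear.Build L {mpoly L[2]} 'rV[L]_#|{: 'X_{1..2 < N}}| *:%R (jet_row N)
    (@jet_row_linear N).

Definition trunc N p : {mpoly L[2]} := \sum_(m : 'X_{1..2 < N}) p@_m *: 'X_[m].

Lemma ord_ge_sub_trunc N p : ord_ge N (p - trunc N p).
Proof.
move=> m hm; rewrite mcoeffB /trunc raddf_sum /= (bigD1 (BMultinom hm)) //= big1 ?addr0.
  by rewrite mcoeffZ mcoeffX eqxx mulr1 subrr.
move=> m' ne; rewrite mcoeffZ mcoeffX (_ : (_ == m) = false) ?mulr0 //.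
by apply: contraNF ne; rewrite bmeqP.
Qed.

Definition mul_jet r a : 'M[L]_(#|{: 'X_{1..2 < r}}|, #|{: 'X_{1..2 < r + r}}|) :=
  \matrix_i jet_row (r + r) ('X_[(enum_val i : 'X_{1..2 < r})] * a).

(** Terms of [u] of degree at least [r] contribute only order [2r] to [u * a], so the product
    depends on the jet of [u] alone. *)
Lemma mul_jetE r a u : ord_ge r a -> jet_row r u *m mul_jet r a = jet_row (r + r) (u * a).
Proof.
move=> ha; have -> : u * a = trunc r u * a + (u - trunc r u) * a.
  by rewrite -mulrDl addrC subrK.
rewrite raddfD /= (_ : jet_row _ ((u - _) * _) = 0) ?addr0; last first.
  by apply/jet_row_eq0/ord_geM => //; apply: ord_ge_sub_trunc.
rewrite mulmx_sum_row /trunc big_distrl raddf_sum /=.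
rewrite [RHS](reindex (enum_val (A := {: 'X_{1..2 < r}}))) /=; last exact/onW_bij/enum_val_bij.
by apply: eq_bigr => i _; rewrite mxE rowK -scalerAl linearZ.
Qed.

Definition mnm2 (i j : nat) : 'X_{1..2} := [multinom if x == 0 :> nat then i else j | x < 2].

Lemma mdeg_mnm2 i j : mdeg (mnm2 i j) = (i + j)%N.
Proof. by rewrite mdegE big_ord_recl big_ord1 !mnmE. Qed.

(** Three disjoint sets of exponents of degree less than [2r]: the box with both exponents below
    [r], and the translates by [(r, 0)] and [(0, r)] of the exponents of degree less than [r]. *)
Lemma card_bmultinom2 r :
  (r * r + (#|{: 'X_{1..2 < r}}| + #|{: 'X_{1..2 < r}}|) <= #|{: 'X_{1..2 < r + r}}|)%N.
Proof.
pose T : finType := (('I_r * 'I_r) + ('X_{1..2 < r} + 'X_{1..2 < r}))%type.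
pose f (t : T) : 'X_{1..2} := match t with
  | inl (i, j) => mnm2 i j
  | inr (inl m) => (m + mnm2 r 0)%MM
  | inr (inr m) => (m + mnm2 0 r)%MM end.
have -> : (r * r + (#|{: 'X_{1..2 < r}}| + #|{: 'X_{1..2 < r}}|))%N = #|{: T}|.
  by rewrite !card_sum card_prod !card_ord.
have small (m : 'X_{1..2 < r}) i : (m i < r)%N.
  by apply: leq_ltn_trans (bmdeg m); rewrite mdegE (bigD1 i) //= leq_addr.
have f_inj : injective f.
  have E t i : f t i = match t with
    | inl (a, b) => if i == 0 :> nat then a : nat else b
    | inr (inl m) => (m i + (if i == 0 :> nat then r else 0))%N
    | inr (inr m) => (m i + (if i == 0 :> nat then 0 else r))%N end.
    by case: t => [[a b]|[m|m]] /=; rewrite ?mnmDE /mnm2 !mnmE.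
  move=> t t' e; have e0 : f t ord0 = f t' ord0 by rewrite e.
  have e1 : f t ord_max = f t' ord_max by rewrite e.
  rewrite !E /= in e0 e1; case: t t' e e0 e1 => [[a b]|[m|m]] [[a' b']|[m'|m']] e /= e0 e1.
  - by congr (inl (_, _)); apply/val_inj.
  - by have := ltn_ord a; lia.
  - by have := ltn_ord b; lia.
  - by have := ltn_ord a'; lia.
  - by congr (inr (inl _)); apply/val_inj; move/addIm: e.
  - by have := small m ord_max; lia.
  - by have := ltn_ord b'; lia.
  - by have := small m ord0; lia.
  - by congr (inr (inr _)); apply/val_inj; move/addIm: e.
rewrite cardE -(size_map f) [in X in (_ <= X)%N]cardE.
rewrite -(size_map (fun m : 'X_{1..2 < r + r} => m : 'X_{1..2})).
apply: uniq_leq_size => [|_ /mapP[t _ ->]]; first by rewrite map_inj_uniq ?enum_uniq.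
suff hm : (mdeg (f t) < r + r)%N.
  by apply/mapP; exists (BMultinom hm); rewrite ?mem_enum.
case: t => [[a b]|[m|m]] /=.
- by rewrite mdeg_mnm2; have := ltn_ord a; have := ltn_ord b; lia.
- by rewrite mdegD mdeg_mnm2; have := bmdeg m; lia.
- by rewrite mdegD mdeg_mnm2; have := bmdeg m; lia.
Qed.

(** The jets of the [E i] and of the monomial multiples of [a] and [b] span, so there are at least
    as many of them as monomials of degree below [2r]. When [n = r ^ 2], there are also at most as
    many, so they are independent. *)
Lemma jets_spanned (n r : nat) (E : 'I_n -> {mpoly L[2]}) a b :
  ord_ge r a -> ord_ge r b ->
  (forall p, exists (c : 'rV[L]_n) u v,
     ord_ge (r + r) (p - (\sum_i c 0 i *: E i + (u * a + v * b)))) ->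
  (r ^ 2 <= n)%N /\
  (n = (r ^ 2)%N -> forall u v, ord_ge (r + r) (u * a + v * b) -> ord_ge r u /\ ord_ge r v).
Proof.
move=> ha hb span.
pose ME : 'M[L]_(n, _) := \matrix_i jet_row (r + r) (E i).
pose Mx := col_mx ME (col_mx (mul_jet r a) (mul_jet r b)).
have full : row_full Mx.
  rewrite -sub1mx; apply/row_subP => i; set w := row i _.
  have [c [u [v /jet_row_eq0]]] := span (\sum_j w 0 j *: 'X_[(enum_val j : 'X_{1..2 < r + r})]).
  rewrite raddfB => /eqP; rewrite subr_eq0 => /eqP e.
  apply/submxP; exists (row_mx c (row_mx (jet_row r u) (jet_row r v))).
  rewrite !mul_row_col !mul_jetE // -raddfD /=.
  have -> : c *m ME = jet_row (r + r) (\sum_i c 0 i *: E i).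
    rewrite mulmx_sum_row raddf_sum /=; by apply: eq_bigr => j _; rewrite rowK linearZ.
  rewrite -raddfD -e raddf_sum; apply/rowP => j; rewrite summxE (bigD1 j) //= big1 => [|j' ne].
    by rewrite addr0 /= /jet_row [RHS]mxE mcoeffZ mcoeffX eqxx mulr1.
  rewrite /= /jet_row mxE mcoeffZ mcoeffX (_ : (_ == _ :> 'X_{1..2}) = false) ?mulr0 //.
  by apply: contraNF ne; rewrite -bmeqP (inj_eq enum_val_inj).
have rk := eqP full; have hc := card_bmultinom2 r; split=> [|en u v /jet_row_eq0].
  by have := rank_leq_row Mx; rewrite rk -mulnn; lia.
have free : row_free Mx.
  by rewrite /row_free eqn_leq rank_leq_row rk en -mulnn.
rewrite raddfD /= -!mul_jetE // => e0.
have : row_mx (0 : 'rV_n) (row_mx (jet_row r u) (jet_row r v)) *m Mx = 0.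
  by rewrite !mul_row_col mul0mx add0r.
move/eqP; rewrite mulmx_free_eq0 // => /eqP; rewrite -row_mx0 => /eq_row_mx[_].
by rewrite -row_mx0 => /eq_row_mx[/jet_row_eq0 ? /jet_row_eq0].
Qed.

End Jets.

(** * Expansions of elements of the local ring *)

Section LocalRing.
Variables (L : fieldType) (k : 'I_3) (A : 'I_3 -> L).
Hypothesis Ak : A k != 0.
Local Notation frac := {fraction {mpoly L[3]}}.
Local Notation chart := (chart k A).
Implicit Types (rho : frac) (P : {mpoly L[2]}).

(** [P] represents, modulo the [N]-th power of the maximal ideal, the expansion at [A] of the
    element [rho] of the local ring. *)
Definition jet_of N rho P : Prop := exists e p q,
  [/\ p \is e.-homog, q \is e.-homog, q.@[A] != 0, rho = tofrac p / tofrac q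
    & ord_ge N (P * chart q - chart p)].

Lemma tofrac_meval_neq0 (q : {mpoly L[3]}) : q.@[A] != 0 -> tofrac q != 0.
Proof. by apply: contraNneq => /eqP; rewrite tofrac_eq0 => /eqP ->; rewrite meval0. Qed.

Lemma chart_inv N (q : {mpoly L[3]}) :
  q.@[A] != 0 -> exists i, ord_ge N (i * chart q - 1).
Proof. by rewrite -(mcoeff0_chart k) => /ord_ge_inv. Qed.

Lemma local_ring_jet N rho : local_ring A rho -> exists P, jet_of N rho P.
Proof.
move=> [e [p [q [hp hq qA ->]]]]; have [i hi] := chart_inv N qA.
exists (chart p * i), e, p, q; split=> //.
move: (chart p) (chart q) hi => cp cq hi.
have -> : cp * i * cq - cp = cp * (i * cq - 1) by ring.
exact: ord_ge_mull.
Qed.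

Lemma jet_of_local_ring N rho P : jet_of N rho P -> local_ring A rho.
Proof. by move=> [e [p [q [hp hq qA -> _]]]]; exists e, p, q. Qed.

(** Equal fractions have equal cross products, and the denominators are units modulo order [N]. *)
Lemma jet_of_uniq N rho P P' : jet_of N rho P -> jet_of N rho P' -> ord_ge N (P - P').
Proof.
move=> [e [p [q [_ _ qA -> h]]]] [e' [p' [q' [_ _ qA' e2 h']]]].
have e3 : p * q' = p' * q.
  apply/eqP; rewrite -tofrac_eq !tofracM.
  by rewrite -eqr_div ?tofrac_meval_neq0 // e2.
have [i hi] := chart_inv N qA; have [i' hi'] := chart_inv N qA'.
have e4 : chart p * chart q' = chart p' * chart q by rewrite -!rmorphM e3.
move: (chart p) (chart q) (chart p') (chart q') h h' hi hi' e4 => cp cq cp' cq' h h' hi hi' e4.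
have -> : P - P' = i * i' * ((P * cq - cp) * cq' - (P' * cq' - cp') * cq)
    - (P - P') * (i * cq * (i' * cq' - 1) + (i * cq - 1)).
  ring: e4.
apply: ord_geB; last by do 1?[apply: ord_ge_mull]; apply: ord_geD => //; apply: ord_ge_mull.
by apply: ord_ge_mull; apply: ord_geB; rewrite mulrC; apply: ord_ge_mull.
Qed.

Lemma jet_ofD N rho rho' P P' :
  jet_of N rho P -> jet_of N rho' P' -> jet_of N (rho + rho') (P + P').
Proof.
move=> [e [p [q [hp hq qA -> h]]]] [e' [p' [q' [hp' hq' qA' -> h']]]].
exists (e + e')%N, (p * q' + p' * q), (q * q'); split.
- by apply: dhomogD; [|rewrite addnC]; apply: dhomogM.
- exact: dhomogM.
- by rewrite mevalM mulf_neq0.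
- by rewrite addf_div ?tofrac_meval_neq0 // -!tofracM -tofracD.
rewrite rmorphD !rmorphM /=.
move: (chart p) (chart q) (chart p') (chart q') h h' => cp cq cp' cq' h h'.
have -> : (P + P') * (cq * cq') - (cp * cq' + cp' * cq) =
  cq' * (P * cq - cp) + cq * (P' * cq' - cp') by ring.
by apply: ord_geD; apply: ord_ge_mull.
Qed.

Lemma jet_ofM N rho rho' P P' :
  jet_of N rho P -> jet_of N rho' P' -> jet_of N (rho * rho') (P * P').
Proof.
move=> [e [p [q [hp hq qA -> h]]]] [e' [p' [q' [hp' hq' qA' -> h']]]].
exists (e + e')%N, (p * p'), (q * q'); split.
- exact: dhomogM.
- exact: dhomogM.
- by rewrite mevalM mulf_neq0.
- by rewrite mulf_div -!tofracM.
rewrite !rmorphM /=; move: (chart p) (chart q) (chart p') (chart q') h h' => cp cq cp' cq' h h'.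
have -> : P * P' * (cq * cq') - cp * cp' =
  (P' * cq') * (P * cq - cp) + cp * (P' * cq' - cp') by ring.
by apply: ord_geD; apply: ord_ge_mull.
Qed.

Lemma jet_ofC N c : jet_of N (tofrac c%:MP) c%:MP.
Proof.
exists 0%N, c%:MP, 1; split.
- by rewrite -[c%:MP]mulr1 mul_mpolyC; apply/dhomogZ/dhomog1.
- exact: dhomog1.
- by rewrite meval1 oner_neq0.
- by rewrite tofrac1 divr1.
- by rewrite rmorph1 mulr1 /chart mmapC subrr; apply: ord_ge0.
Qed.

Lemma jet_of_sum N (I : finType) (rho : I -> frac) (P : I -> {mpoly L[2]}) :
  (forall i, jet_of N (rho i) (P i)) -> jet_of N (\sum_i rho i) (\sum_i P i).
Proof.
move=> h; apply: (big_ind2 (jet_of N)) => //; last by move=> *; apply: jet_ofD.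
by have := jet_ofC N 0; rewrite mpolyC0 tofrac0.
Qed.

Lemma jet_of_surj N P : exists rho, jet_of N rho P.
Proof.
elim/mpoly_alg_ind: P => [c|i|p q [rho h] [rho' h']|p q [rho h] [rho' h']].
- by exists (tofrac c%:MP); apply: jet_ofC.
(* In the chart [t_k = A_k] the quotient of this form by [t_k] is exactly the affine coordinate
   ['X_i]. *)
- pose p : {mpoly L[3]} := A k *: 'X_(lift k i) - A (lift k i) *: 'X_k.
  exists (tofrac p / tofrac 'X_k), 1%N, p, 'X_k; split=> //.
  + by apply: rpredB; apply: dhomogZ; rewrite dhomogX /= mdeg1.
  + by rewrite dhomogX /= mdeg1.
  + by rewrite mevalXU.
  rewrite rmorphB /= !chartZ /chart !mmapX !mmap1U /chart_var liftK unlift_none /= addr0.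
  rewrite -!mul_mpolyC; set a := _%:MP; set b := _%:MP.
  have -> : 'X_i * a - (a * (b + 'X_i) - b * a) = 0 by ring.
  exact: ord_ge0.
- by exists (rho + rho'); apply: jet_ofD.
- by exists (rho * rho'); apply: jet_ofM.
Qed.

Lemma jet_of_dehomog N d (f l : {mpoly L[3]}) :
  f \is d.-homog -> l \is 1.-homog -> l.@[A] != 0 ->
  exists i, jet_of N (dehomog f l) (i * chart f).
Proof.
move=> hf hl lA; have lA' : (l ^+ (msize f).-1).@[A] != 0 by rewrite rmorphXn expf_neq0.
have [i hi] := chart_inv N lA'; exists i, (msize f).-1, f, (l ^+ (msize f).-1); split=> //.
- exact: dhomog_msize hf.
- by rewrite -[(msize f).-1 in X in _ \is X.-homog]mul1n; apply: dhomogMn.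
move: (chart _) hi (chart f) => cl hi cf.
have -> : i * cf * cl - cf = cf * (i * cl - 1) by ring.
exact: ord_ge_mull.
Qed.

(** If the tangent cones of two curves of multiplicity [r] at [A] share a component, then the
    products of the two equations by the monomials of degree less than [r] are dependent modulo
    order [2r], which leaves more than [r ^ 2] dimensions for the quotient. *)
Lemma inter_mult_ge d (f g : {mpoly L[3]}) n r :
  f \is d.-homog -> g \is d.-homog -> ord_ge r (chart f) -> ord_ge r (chart g) ->
  is_inter_mult A f g n ->
  (r ^ 2 <= n)%N /\
  (n = (r ^ 2)%N -> forall u v, ord_ge (r + r) (u * chart f + v * chart g) ->
     ord_ge r u /\ ord_ge r v).
Proof.
move=> hf hg off ogg [e [he hspan]].
have [E hE] := fin_all_exists (fun i => local_ring_jet (r + r) (he i)).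
apply: (jets_spanned (E := E)) => // P.
(* Lift the jet to the local ring, decompose there along [e] modulo the ideal, and expand back. *)
have [rho hP] := jet_of_surj (r + r) P.
have [c [[l [u [v [hl lA hu hv e1]]]] _]] := hspan rho (jet_of_local_ring hP).
have [U hU] := local_ring_jet (r + r) hu; have [V hV] := local_ring_jet (r + r) hv.
have [i hi] := jet_of_dehomog (r + r) hf hl lA.
have [j hj] := jet_of_dehomog (r + r) hg hl lA.
exists c, (U * i), (V * j); apply: (jet_of_uniq hP).
rewrite -[rho](subrK (\sum_(i < n) tofrac (c 0 i)%:MP * e i)) e1 addrC.
apply: jet_ofD.
  by apply: jet_of_sum => x; rewrite -mul_mpolyC; apply: jet_ofM (jet_ofC _ _) (hE x).
by rewrite -(mulrA U) -(mulrA V); exact: jet_ofD (jet_ofM hU hi) (jet_ofM hV hj).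
Qed.

End LocalRing.

(** * Sylvester matrices *)

Section Sylvester.
Variables (K : fieldType) (r : nat).
Implicit Types (p a u : {mpoly K[2]}).

(** The part of degree [2r + 1]. It has [2r + 2] coefficients, so two blocks of [r + 1] rows stack
    to a square matrix. *)
Definition form_row p : 'rV[K]_(r.+1 + r.+1) := \row_j p@_(mnm2 j (r.+1 + r - j)).

Lemma form_row_linear : linear form_row.
Proof. by move=> c p q; apply/rowP => i; rewrite !mxE mcoeffD mcoeffZ. Qed.

HB.instance Definition _ :=
  GRing.isLinear.Build K {mpoly K[2]} 'rV[K]_(r.+1 + r.+1) *:%R form_row form_row_linear.

Lemma ord_ge_form_row p : ord_ge (r.+1 + r) p -> form_row p = 0 -> ord_ge (r.+1 + r.+1) p.
Proof.
move=> hp p0 m; rewrite addnS ltnS leq_eqVlt => /orP[/eqP hm|]; last exact: hp.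
have hm' : (m ord0 + m ord_max = r.+1 + r)%N.
  by rewrite -hm mdegE big_ord_recl big_ord1; congr (_ + m _)%N; apply/val_inj.
have m0 : (m ord0 < r.+1 + r.+1)%N by lia.
have := congr1 (fun w : 'rV_(r.+1 + r.+1) => w 0 (Ordinal m0)) p0; rewrite !mxE /= => e.
apply: etrans e.
congr (_@__); apply/mnmP => i; rewrite mnmE.
case: (unliftP ord0 i) => [j ->|->] //=.
by rewrite [j]ord1 (_ : lift _ _ = ord_max); [lia|apply/val_inj].
Qed.

Definition form_of_row (w : 'rV[K]_r.+1) : {mpoly K[2]} :=
  \sum_(i < r.+1) w 0 i *: 'X_[mnm2 i (r - i)].

Lemma ord_ge_form_of_row w : ord_ge r (form_of_row w).
Proof.
apply: ord_ge_sum => i _; apply: ord_geZ.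
have := @ord_ge_mpolyX _ K (mnm2 i (r - i)); rewrite mdeg_mnm2 subnKC //.
by have := ltn_ord i.
Qed.

Lemma form_of_row_eq0 w : ord_ge r.+1 (form_of_row w) -> w = 0.
Proof.
move=> h; apply/rowP => i; rewrite mxE.
have hi : (i <= r)%N by have := ltn_ord i.
have := h (mnm2 i (r - i)); rewrite mdeg_mnm2 subnKC // ltnS leqnn => /(_ isT).
rewrite raddf_sum (bigD1 i) //= mcoeffZ mcoeffX eqxx mulr1 big1 ?addr0 // => j ne.
rewrite mcoeffZ mcoeffX (_ : (_ == _) = false) ?mulr0 //.
apply: contraNF ne => /eqP/mnmP/(_ ord0); rewrite !mnmE /= => e.
exact/eqP/val_inj.
Qed.

(** Only the part of [a] of degree [r + 1] enters: the tangent cone if [a] has order [r + 1]. *)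
Definition sylvester a : 'M[K]_(r.+1, r.+1 + r.+1) :=
  \matrix_i form_row ('X_[mnm2 i (r - i)] * a).

Lemma mul_sylvester w a : w *m sylvester a = form_row (form_of_row w * a).
Proof.
rewrite mulmx_sum_row /form_of_row big_distrl raddf_sum /=.
by apply: eq_bigr => i _; rewrite rowK -scalerAl linearZ.
Qed.

End Sylvester.

(** The Sylvester matrix of [a] and [b] is invertible over [F], and its rows are combinations of
    the products of the [m j] by monomials, which are defined over [K]: so these products span
    all forms of degree [2 r + 1] over [K]. *)
Lemma sylvester_span (K F : fieldType) (iota : {rmorphism K -> F}) (I : finType) (r : nat)
    (m : I -> {mpoly K[2]}) (x y : I -> F)
    (a := \sum_j x j *: map_mpoly iota (m j)) (b := \sum_j y j *: map_mpoly iota (m j)) :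
  (forall j, ord_ge r.+1 (m j)) ->
  (forall u v, ord_ge (r.+1 + r.+1) (u * a + v * b) -> ord_ge r.+1 u /\ ord_ge r.+1 v) ->
  forall p, ord_ge r.*2.+1 p ->
  exists q : I -> {mpoly K[2]}, (forall j, ord_ge r (q j)) /\
    ord_ge r.+1.*2 (p - \sum_j q j * m j).
Proof.
move=> hm indep p hp; pose W := (\sum_j <<sylvester r (m j)>>)%MS.
have hsum z : ord_ge r.+1 (\sum_j z j *: map_mpoly iota (m j)).
  by apply: ord_ge_sum => j _; apply: ord_geZ => w hw; rewrite mcoeff_map_mpoly (hm j w hw) raddf0.
have subW z : (sylvester r (\sum_j z j *: map_mpoly iota (m j)) <= map_mx iota W)%MS.
  have -> : sylvester r (\sum_j z j *: map_mpoly iota (m j)) =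
      \sum_j z j *: map_mx iota (sylvester r (m j)).
    apply/matrixP => i l; rewrite !mxE summxE big_distrr raddf_sum /=.
    apply: eq_bigr => j _; rewrite !mxE -scalerAr mcoeffZ; congr (_ * _).
    by rewrite -mcoeff_map_mpoly rmorphM /= map_mpolyX.
  apply: summx_sub => j _; apply: scalemx_sub; rewrite map_submx.
  by rewrite (sumsmx_sup j) // genmxE.
(* A kernel row is a pair of forms [u], [v] of degree [r] with [u * a + v * b] of order at least
   [2r + 2]; [indep] raises their orders to [r + 1], so both are zero. *)
have free : row_free (col_mx (sylvester r a) (sylvester r b)).
  apply: inj_row_free => w; rewrite -[w]hsubmxK mul_row_col !mul_sylvester -raddfD /= => e.
  have [|hu hv] := indep (form_of_row (lsubmx w)) (form_of_row (rsubmx w)).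
    apply: ord_ge_form_row => //; apply: ord_geD; rewrite addnC; apply: ord_geM;
    by [apply: ord_ge_form_of_row | apply: hsum].
  by rewrite (form_of_row_eq0 hu) (form_of_row_eq0 hv) row_mx0.
(* Descent from [F] to [K]: rank is invariant under field extension, and over [F] the space [W]
   contains the rows of an invertible matrix. *)
have full : row_full W.
  rewrite /row_full eqn_leq rank_leq_col -(mxrank_map iota) /=.
  apply: leq_trans (_ : \rank (col_mx (sylvester r a) (sylvester r b)) <= _)%N.
    by rewrite (eqP free).
  by apply: mxrankS; rewrite col_mx_sub !subW.
have /sub_sumsmxP[U eU] := submx_full (form_row r p) full.
have mem j : (U j *m <<sylvester r (m j)>> <= sylvester r (m j))%MS.
  by rewrite (submx_trans (submxMl _ _)) ?genmxE.
have [u hu] := fin_all_exists (fun j => submxP (mem j)).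
exists (fun j => form_of_row (u j)); split=> [j|]; first exact: ord_ge_form_of_row.
rewrite -addnn; apply: ord_ge_form_row.
  apply: ord_geB; first by rewrite addSn addnn.
  by apply: ord_ge_sum => j _; rewrite addnC; apply: ord_geM => //; apply: ord_ge_form_of_row.
rewrite raddfB raddf_sum /= eU; apply/eqP; rewrite subr_eq0; apply/eqP/eq_bigr => j _.
by rewrite hu mul_sylvester.
Qed.

(** * Multiplicities of generic members *)

Section Mult.
Variable L : fieldType.
Implicit Types (A : 'I_3 -> L) (f : {mpoly L[3]}).

Lemma mult_vanish A f m : (mdeg m < mult A f)%N -> (f^`M[m]).@[A] = 0.
Proof.
move: m; rewrite /mult; elim/big_ind: _ => [//|r s hr hs m|r /forallP h m hm].
  by rewrite leq_max => /orP[/hr|/hs].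
exact/eqP/(h (BMultinom hm)).
Qed.

Lemma mult_ge A f r : (r < msize f)%N ->
  (forall m, (mdeg m < r)%N -> (f^`M[m]).@[A] = 0) -> (r <= mult A f)%N.
Proof.
move=> hr h; apply: (@leq_bigmax_cond _ _ (fun i : 'I_(msize f) => i : nat) (Ordinal hr)).
by apply/forallP => m; rewrite h ?bmdeg.
Qed.

Lemma mult_lt_msize A f : (0 < mult A f)%N -> (mult A f < msize f)%N.
Proof.
rewrite /mult; elim/big_ind: _ => // r s hr hs.
by rewrite /maxn; case: ifP.
Qed.

Lemma msize_homog d f : f \is d.-homog -> f != 0 -> msize f = d.+1.
Proof.
move=> hf f0; rewrite mpolySpred //; congr _.+1.
exact: dhomog_uniq f0 (dhomog_msize hf) hf.
Qed.

End Mult.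

Section MapMpoly.
Variables (K F : fieldType) (iota : {rmorphism K -> F}) (n : nat).
Implicit Types (p : {mpoly K[n]}).

Lemma map_mpoly_homog d p : p \is d.-homog -> map_mpoly iota p \is d.-homog.
Proof.
move/dhomogP => hp; apply/dhomogP => m; rewrite mcoeff_msupp mcoeff_map_mpoly => h.
by apply: hp; rewrite mcoeff_msupp; apply: contraNneq h => ->; rewrite raddf0.
Qed.

Lemma mderivm_map_mpoly m p : (map_mpoly iota p)^`M[m] = map_mpoly iota p^`M[m].
Proof.
apply/mpolyP => m'; rewrite mcoeff_map_mpoly !mcoeff_mderivm mcoeff_map_mpoly.
by rewrite -raddfMn.
Qed.

Lemma meval_map_mpoly A p : (map_mpoly iota p).@[iota \o A] = iota p.@[A].
Proof.
elim/mpoly_alg_ind: p => [c|i|p q hp hq|p q hp hq].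
- by rewrite map_mpolyC !mevalC.
- by rewrite map_mpolyX !mevalXU.
- by rewrite raddfD !mevalD hp hq rmorphD.
- by rewrite rmorphM !mevalM hp hq rmorphM.
Qed.

End MapMpoly.

Lemma chart_map_mpoly (K F : fieldType) (iota : {rmorphism K -> F}) n (k : 'I_n.+1)
    (A : 'I_n.+1 -> K) (p : {mpoly K[n.+1]}) :
  chart k (iota \o A) (map_mpoly iota p) = map_mpoly iota (chart k A p).
Proof.
elim/mpoly_alg_ind: p => [c|i|p q hp hq|p q hp hq].
- by rewrite map_mpolyC /chart !mmapC map_mpolyC.
- rewrite map_mpolyX /chart !mmapX !mmap1U /chart_var raddfD /= map_mpolyC.
  by case: (unlift k i) => [j|] /=; rewrite ?map_mpolyX ?raddf0.
- by rewrite raddfD !rmorphD /= hp hq.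
- by rewrite !rmorphM /= hp hq.
Qed.

Section GenericMembers.
Variables (K : closedFieldType) (charK : [pchar K] =i pred0).
Variable F : alg_closure {fraction {mpoly K[3 + 3]}}.
Variables (d : nat) (M : 3.-tuple {mpoly K[3]}).
Hypothesis homogM : homog_map d M.
Variable A : 'I_3 -> K.

Definition const_emb : {rmorphism K -> F} :=
  (ac_emb F \o (@tofrac {mpoly K[3 + 3]} \o @mpolyC (3 + 3) K))%FUN.

Definition generic_member (v : 'I_3 -> 'I_(3 + 3)) : {mpoly F[3]} :=
  \sum_(i < 3) coefF F 'X_(v i) *: map_mpoly const_emb (tnth M i).

Lemma V1E : V1 F M = generic_member (@lshift 3 3). Proof. by []. Qed.

Lemma V2E : V2 F M = generic_member (@rshift 3 3). Proof. by []. Qed.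

Lemma generic_member_homog v : generic_member v \is d.-homog.
Proof. by apply: rpred_sum => i _; apply/dhomogZ/map_mpoly_homog/homogM. Qed.

(** Distinct variables are linearly independent over [K], and the polynomial ring embeds in [F].
    Vanishing conditions on [V1] thus pass to every component of [M]. *)
Lemma generic_comb_eq0 (v : 'I_3 -> 'I_(3 + 3)) (c : 'I_3 -> K) : injective v ->
  \sum_i coefF F 'X_(v i) * const_emb (c i) = 0 -> forall i, c i = 0.
Proof.
move=> v_inj h i.
have : coefF F (\sum_i 'X_(v i) * (c i)%:MP) = 0.
  rewrite -h /coefF !rmorph_sum; apply: eq_bigr => j _.
  by rewrite !rmorphM.
move/eqP; rewrite /coefF fmorph_eq0 tofrac_eq0 => /eqP/(congr1 (mcoeff U_(v i))).
rewrite mcoeff0 raddf_sum (bigD1 i) //= mulrC mul_mpolyC mcoeffZ mcoeffX eqxx mulr1.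
rewrite big1 ?addr0 // => j ne; rewrite mulrC mul_mpolyC mcoeffZ mcoeffX.
by rewrite eq_mnm1 (inj_eq v_inj) (negPf ne) mulr0.
Qed.

Lemma generic_member_deriv v m :
  ((generic_member v)^`M[m]).@[pointF F A] =
  \sum_i coefF F 'X_(v i) * const_emb ((tnth M i)^`M[m]).@[A].
Proof.
rewrite /generic_member !raddf_sum /=; apply: eq_bigr => i _.
by rewrite mderivmZ mevalZ mderivm_map_mpoly (meval_map_mpoly const_emb A).
Qed.

Local Notation r := (mult (pointF F A) (V1 F M)).

Lemma generic_mult_vanish i m : (mdeg m < r)%N -> ((tnth M i)^`M[m]).@[A] = 0.
Proof.
move/mult_vanish; rewrite V1E generic_member_deriv => /generic_comb_eq0.
by apply; apply: lshift_inj.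
Qed.

Lemma generic_mult_gt0 : base_locus M A -> nonzero_map M -> (0 < r)%N.
Proof.
move=> [_ MA] [i Mi]; apply: mult_ge => [|m]; last first.
  rewrite ltnS leqn0 mdeg_eq0 V1E => /eqP ->; rewrite generic_member_deriv big1 // => j _.
  by rewrite mderivm0m MA rmorph0 mulr0.
(* [mult] ranges below [msize], so [V1] must not be constant. A constant [V1] is zero, as it
   vanishes at [A], and then every component of [M] is zero. *)
rewrite ltnNge; apply: contra Mi => /msize1_polyC e.
have V0 : V1 F M = 0.
  rewrite e; suff -> : (V1 F M)@_0 = 0 by [].
  have : (V1 F M).@[pointF F A] = 0.
    rewrite V1E -[generic_member _]mderivm0m generic_member_deriv big1 // => j _.
    by rewrite mderivm0m MA rmorph0 mulr0.
  by rewrite {1}e mevalC.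
apply/eqP/mpolyP => m; rewrite mcoeff0.
apply: (@generic_comb_eq0 (@lshift 3 3) (fun i => (tnth M i)@_m)); first exact: lshift_inj.
have := congr1 (mcoeff m) V0; rewrite V1E /generic_member raddf_sum mcoeff0 /= => e0.
by apply: etrans e0; apply: eq_bigr => j _; rewrite mcoeffZ mcoeff_map_mpoly.
Qed.

Variable k : 'I_3.
Hypothesis Ak : A k != 0.

Lemma chart_generic_member v :
  chart k (pointF F A) (generic_member v) =
  \sum_i coefF F 'X_(v i) *: map_mpoly const_emb (chart k A (tnth M i)).
Proof.
rewrite /generic_member raddf_sum /=; apply: eq_bigr => i _.
by rewrite chartZ -chart_map_mpoly.
Qed.

Lemma ord_ge_generic_chart i : ord_ge r (chart k A (tnth M i)).
Proof. by apply: ord_ge_chart => // m; apply: generic_mult_vanish. Qed.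

Lemma ord_ge_chart_generic_member v : ord_ge r (chart k (pointF F A) (generic_member v)).
Proof.
rewrite chart_generic_member; apply: ord_ge_sum => i _; apply: ord_geZ => m hm.
by rewrite mcoeff_map_mpoly (ord_ge_generic_chart i hm) raddf0.
Qed.

Lemma base_mult_ge n : is_base_mult F M A n ->
  (r ^ 2 <= n)%N /\ (n = (r ^ 2)%N -> forall u v,
    ord_ge (r + r) (u * chart k (pointF F A) (V1 F M) + v * chart k (pointF F A) (V2 F M)) ->
    ord_ge r u /\ ord_ge r v).
Proof.
apply: inter_mult_ge; rewrite ?V1E ?V2E.
- by rewrite (fmorph_eq0 const_emb).
- exact: generic_member_homog.
- exact: generic_member_homog.
- exact: ord_ge_chart_generic_member.
- exact: ord_ge_chart_generic_member.
Qed.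

Lemma transversal_reduction p : is_base_mult F M A (r ^ 2) -> (0 < r)%N ->
  ord_ge r.*2.-1 p ->
  exists q : 'I_3 -> {mpoly K[2]}, (forall j, ord_ge r.-1 (q j)) /\
    ord_ge r.*2 (p - \sum_j q j * chart k A (tnth M j)).
Proof.
move=> /base_mult_ge[_ /(_ erefl)]; rewrite V1E V2E !chart_generic_member -V1E.
have := ord_ge_generic_chart; case: r => // r' om indep _ hp.
exact: (sylvester_span om indep).
Qed.

End GenericMembers.

(** * Restriction to lines *)

Section Lines.
Variables (K : comNzRingType) (n : nat) (b a : 'I_n -> K).
Implicit Types (p : {mpoly K[n]}).

Definition line_var (i : 'I_n) : {poly K} := (b i)%:P + a i *: 'X.

Definition on_line : {mpoly K[n]} -> {poly K} := mmap (@polyC K) line_var.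

HB.instance Definition _ := GRing.RMorphism.on on_line.

Lemma horner_mmap (x : 'I_n -> {poly K}) s p :
  (mmap (@polyC K) x p).[s] = p.@[fun i => (x i).[s]].
Proof.
rewrite -[LHS]/(horner_eval s _) rmorph_mmap; apply: eq_bigr => m _.
by rewrite /= /horner_eval hornerC.
Qed.

Lemma coef0_on_line p : (on_line p)`_0 = p.@[b].
Proof.
rewrite -horner_coef0 horner_mmap; apply: meval_eq => i.
by rewrite hornerD hornerC hornerZ hornerX mulr0 addr0.
Qed.

Lemma coef1_on_line p : (on_line p)`_1 = \sum_i a i * (p^`M(i)).@[b].
Proof.
elim/mpoly_alg_ind: p => [c|i|p q hp hq|p q hp hq].
- rewrite /on_line mmapC coefC big1 // => i _; by rewrite mderivC meval0 mulr0.
- rewrite /on_line mmapX mmap1U coefD coefC coefZ coefX mulr1 add0r.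
  rewrite (bigD1 i) //= mderivX mnm1E eqxx mevalZ mul1r.
  rewrite (_ : U_(i) - U_(i) = 0)%MM; last by apply/mnmP => x; rewrite mnmBE subnn mnm0E.
  rewrite mpolyX0 meval1 mulr1 big1 ?addr0 // => j ne.
  by rewrite mderivX mnm1E eq_sym (negPf ne) scale0r meval0 mulr0.
- rewrite rmorphD coefD hp hq -big_split; apply: eq_bigr => i _ /=.
  by rewrite mderivD mevalD mulrDr.
- rewrite rmorphM coefM big_ord_recl big_ord1 /= !coef0_on_line hp hq.
  rewrite big_distrr big_distrl -big_split; apply: eq_bigr => i _ /=.
  by rewrite mderivM mevalD !mevalM; ring.
Qed.

(** A formal leading coefficient: [c] may be zero, which makes it multiplicative without side
    conditions. *)
Definition top_coef e (q : {poly K}) c := (size q <= e.+1)%N /\ q`_e = c.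

Lemma top_coefM e e' q q' c c' :
  top_coef e q c -> top_coef e' q' c' -> top_coef (e + e') (q * q') (c * c').
Proof.
move=> [s <-] [s' <-]; split; first by apply: leq_trans (size_polyMleq _ _) _; lia.
have he : (e < (e + e').+1)%N by lia.
rewrite coefM (bigD1 (Ordinal he)) //= addKn big1 ?addr0 // => i ne.
have {}ne : (i : nat) != e by apply: contraNneq ne => e1; apply/eqP/val_inj.
case: (ltngtP i e) ne => // hi _.
  by rewrite [q'`__]nth_default ?mulr0 //; apply: leq_trans s' _; lia.
by rewrite [q`__]nth_default ?mul0r //; apply: leq_trans s _.
Qed.

(** The point [a] is the point at infinity of the line [b + s a]. *)
Lemma top_coef_on_line d p : p \is d.-homog -> top_coef d (on_line p) p.@[a].
Proof.
move/dhomogP => hp; rewrite /on_line /mmap mevalE; rewrite !big_seq.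
apply: (big_ind2 (top_coef d)) => [|q c q' c' [s <-] [s' <-]|m /hp /= <-].
- by split; rewrite ?size_poly0 ?coef0.
- by split; rewrite ?coefD //; apply: leq_trans (size_polyD _ _) _; rewrite geq_max s.
rewrite mdegE -[(\sum_i m i)%N]add0n; apply: top_coefM.
  by split; rewrite ?coefC //; apply: leq_trans (size_polyC_leq1 _) _.
apply: (big_ind3 (fun q e c => top_coef e q c)) => [|q e c q' e' c'|i _].
- by split; rewrite ?coef1 ?size_poly1.
- exact: top_coefM.
elim: (m i) => [|k ih]; first by split; rewrite ?expr0 ?coef1 ?size_poly1.
rewrite !exprS -add1n; apply: top_coefM ih; split.
  apply: leq_trans (size_polyD _ _) _; rewrite geq_max (leq_trans (size_polyC_leq1 _)) //=.
  by apply: leq_trans (size_scale_leq _ _) _; rewrite size_polyX.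
by rewrite coefD coefC coefZ coefX mulr1 add0r.
Qed.

End Lines.

Lemma meval_origin (K : comNzRingType) n (p : {mpoly K[n]}) : p.@[fun=> 0] = p@_0.
Proof.
elim/mpoly_alg_ind: p => [c|i|p q hp hq|p q hp hq].
- by rewrite mevalC mcoeffC eqxx mulr1.
- by rewrite mevalXU mcoeffX mnm1_eq0.
- by rewrite mevalD mcoeffD hp hq.
- by rewrite mevalM rmorphM hp hq.
Qed.

(** Restricted to lines, the polynomial has every scalar as a root and so is zero; hence its partial
    derivatives vanish everywhere too, and inductively so do all coefficients. *)
Lemma mpoly_fun_eq0 (K : closedFieldType) (charK : [pchar K] =i pred0) n (p : {mpoly K[n]}) :
  (forall a, p.@[a] = 0) -> p = 0.
Proof.
have natK_neq0 x : x.+1%:R != 0 :> K by move/pcharf0P: charK => ->.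
have vanish_deriv (q : {mpoly K[n]}) i : (forall a, q.@[a] = 0) -> forall a, (q^`M(i)).@[a] = 0.
  move=> hq b; pose a (j : 'I_n) : K := (j == i)%:R.
  have l0 : on_line b a q = 0.
    apply/eqP; apply/negPn/negP => /closed_nonrootP[s] /negP; apply.
    by rewrite /root horner_mmap hq.
  have := coef1_on_line b a q; rewrite l0 coef0 (bigD1 i) //= /a eqxx mul1r big1 ?addr0 //.
  by move=> j /negPf ->; rewrite mul0r.
move=> hp; apply/mpolyP => m; rewrite mcoeff0.
elim: {m}(mdeg m) {-2}m (erefl (mdeg m)) p hp => [|k ih] m hm p hp.
  move/eqP: hm; rewrite mdeg_eq0 => /eqP ->; have := hp (fun=> 0).
  by rewrite meval_origin.
have [i mi] : exists i, m i != 0%N.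
  apply/existsP; rewrite -negb_forall; apply/negP => /forallP h.
  have : m = 0%MM by apply/mnmP => i; rewrite mnm0E; apply/eqP.
  by move=> m0; rewrite m0 mdeg0 in hm.
have Ui : (U_(i) <= m)%MM by rewrite lep1mP.
have : p^`M(i)@_(m - U_(i)) = 0.
  apply: ih (vanish_deriv _ i hp).
  by move: hm; rewrite -{1}(submK Ui) mdegD mdeg1 addn1 => -[].
rewrite mcoeff_mderiv submK // -mulr_natr => /eqP; rewrite mulf_eq0.
by rewrite (negPf (natK_neq0 _)) orbF => /eqP.
Qed.

(** A nonconstant [p / gcd(p, q)] would have a root [s], yet the full power of ['X - s] in [p]
    divides the gcd. *)
Lemma dvdp_closed (K : closedFieldType) (p q : {poly K}) : p != 0 ->
  (forall s e, ('X - s%:P) ^+ e %| p -> ('X - s%:P) ^+ e %| q) -> p %| q.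
Proof.
move=> p0 h; set g := gcdp p q.
have g0 : g != 0 by rewrite gcdp_eq0 (negPf p0).
have /dvdpP[u eu] : g %| p by apply: dvdp_gcdl.
have u0 : u != 0 by apply: contraNneq p0 => u0; rewrite eu u0 mul0r.
have [/size_poly1P[c c0 ec]|/closed_rootP[s us]] := boolP (size u == 1%N).
  by rewrite eu ec mul_polyC dvdpZl // dvdp_gcdr.
have := leqnn (mup s p); rewrite mup_geq // => hs.
have : ('X - s%:P) ^+ mup s p %| g by rewrite dvdp_gcd hs h.
by rewrite -mup_geq // eu mupM // addnC -[X in (_ <= X)%N]addn0 leq_add2l
  leqNgt -XsubC_dvd // dvdp_XsubCl us.
Qed.

(** Divide by the gcd [c]: a common root [s] of the quotients would make [('X - s) * c] a common
    divisor. *)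
Lemma common_factor (K : fieldType) (I : finType) (x : I -> {poly K}) :
  (exists i, x i != 0) -> exists c y,
    [/\ c != 0, forall i, x i = c * y i & forall s, exists i, (y i).[s] != 0].
Proof.
move=> [i0 xi0].
have [c [hc maxc]] : exists c, {in codom x, forall q, c %| q} /\
    forall g, {in codom x, forall q, g %| q} -> g %| c.
  elim: (codom x) => [|q s [c [hc maxc]]].
    by exists 0; split=> // g _; apply: dvdp0.
  exists (gcdp q c); split=> [q'|g hg].
    rewrite inE => /predU1P[->|/hc]; first exact: dvdp_gcdl.
    exact/dvdp_trans/dvdp_gcdr.
  rewrite dvdp_gcd hg ?mem_head //=; apply: maxc => q' hq'.
  by apply: hg; rewrite inE hq' orbT.
have c0 : c != 0 by apply: dvdpN0 xi0; apply/hc/codom_f.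
have [y hy] := fin_all_exists (fun i => dvdpP _ _ (hc _ (codom_f x i))).
exists c, y; split=> // [i|s]; first by rewrite hy mulrC.
have [/existsP //|/existsPn h] := boolP [exists i, (y i).[s] != 0].
have : ('X - s%:P) * c %| c.
  apply: maxc => _ /codomP[i ->]; rewrite hy dvdp_mul // dvdp_XsubCl.
  by have := h i; rewrite negbK.
move/dvdp_leq => /(_ c0); rewrite size_mul ?polyXsubC_eq0 // size_XsubC.
by rewrite addSn ltnn.
Qed.

(** * The birational map on a line *)

Section MonomialQuotients.
Variables (K : fieldType) (n : nat).
Implicit Types (p q : {mpoly K[n]}).

(** Every monomial of [p] contains ['X_i], because multiplying by ['X_j] cannot introduce it. *)
Lemma dvd_var (i j : 'I_n) p q : i != j -> p * 'X_j = q * 'X_i -> exists g, p = g * 'X_i.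
Proof.
move=> ij e; exists (\sum_(m <- msupp p) p@_m *: 'X_[m - U_(i)]).
rewrite {1}[p]mpolyE big_distrl; apply: eq_big_seq => m hm /=.
rewrite -scalerAl -mpolyXD submK // lep1mP; apply/negP => /eqP mi0.
move: hm; rewrite mcoeff_msupp -(mcoeffMX p U_(j)) e => /negP; apply; apply/eqP.
apply: memN_msupp_eq0; rewrite (perm_mem (msuppMX _ _)); apply/negP => /mapP[m' _ /mnmP/(_ i)].
by rewrite !mnmDE mi0 !mnm1E eqxx eq_sym (negPf ij).
Qed.

Lemma homog_mulX i e p : p * 'X_i \is e.-homog -> p != 0 -> exists2 d, e = d.+1 & p \is d.-homog.
Proof.
move=> /dhomogP h p0; have deg m : m \in msupp p -> e = (mdeg m).+1.
  move=> hm; rewrite -addn1 -(mdeg1 i) -mdegD; apply/esym/h.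
  by rewrite mcoeff_msupp addmC mcoeffMX -mcoeff_msupp.
exists (mdeg (mlead p)); first exact/deg/mlead_supp.
apply/dhomogP => m /deg e1; apply: succn_inj; rewrite -e1.
exact/deg/mlead_supp.
Qed.

End MonomialQuotients.

(** Turns projective equality with the identity map into a polynomial factor. *)
Lemma proportional_to_vars (K : fieldType) (P : 'I_3 -> {mpoly K[3]}) :
  (forall i j, P i * 'X_j = P j * 'X_i) -> exists g, forall i, P i = g * 'X_i.
Proof.
move=> h; have [g hg] := dvd_var (isT : ord0 != ord_max :> 'I_3) (h ord0 ord_max).
exists g => i; apply: (mulIf (_ : 'X_ord0 != 0)).
  by rewrite -msize_poly_eq0 msizeX.
by rewrite h hg; ring.
Qed.

Section Birational.
Variables (K : closedFieldType) (charK : [pchar K] =i pred0).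
Variable F : alg_closure {fraction {mpoly K[3 + 3]}}.
Variables (d : nat) (M : 3.-tuple {mpoly K[3]}).
Hypotheses (homogM : homog_map d M) (transM : transversal_map F M).
Variables (e : nat) (N : 3.-tuple {mpoly K[3]}) (h : {mpoly K[3]}).
Hypotheses (homogN : homog_map e N) (MN : forall i, tnth M i \mPo N = h * 'X_i).
Variables (f : {mpoly K[3]}).
Hypotheses (homogf : f \is d.-homog)
  (multf : forall A, base_locus M A -> (mult (pointF F A) (V1 F M) <= mult A f)%N).

Lemma dvdp_on_line a b i j : h.@[b] != 0 -> a i * b j - a j * b i != 0 ->
  on_line b a h %| on_line b a (f \mPo N).
Proof.
move=> hb indep; pose t := line_var b a; pose nu l := on_line b a (tnth N l).
have M_nu l : mmap (@polyC K) nu (tnth M l) = on_line b a h * t l.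
  by rewrite -mmap_comp_mpoly MN rmorphM /= mmapX mmap1U.
have H0 : on_line b a h != 0.
  by apply: contraNneq hb => h0; rewrite -(coef0_on_line b a) h0 coef0.
(* Two coordinates of the moving point have a nonzero constant combination, so the [t l] share no
   factor. *)
have det_t : a i *: t j - a j *: t i = (a i * b j - a j * b i)%:P.
  rewrite /t /line_var -!mul_polyC polyCB !polyCM; ring.
have t_neq0 : exists l, t l != 0.
  apply/existsP; apply: contraNT indep => /existsPn t0.
  have {}t0 l : t l = 0 by have := t0 l; rewrite negbK => /eqP.
  by have /eqP := det_t; rewrite !t0 !scaler0 subrr eq_sym polyC_eq0.
have [l0 tl0] := t_neq0.
have nu_neq0 : exists l, nu l != 0.
  (* [h * 'X_i] has degree [d * e], which is therefore positive. With [d > 0], an arc [nu] that is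
     identically zero would kill [h * t l0]. *)
  have d_gt0 : (0 < d)%N.
    have h0 : h != 0 by apply: contraNneq hb => ->; rewrite meval0.
    have := dhomog_comp_mpoly (homogM i) homogN; rewrite MN => /homog_mulX/(_ h0)[D eD _].
    by case: (d) eD.
  apply/existsP; apply: contraT => /existsPn nu0.
  have {}nu0 l : nu l = 0 by have := nu0 l; rewrite negbK => /eqP.
  have := M_nu l0; rewrite (@eq_mmap _ _ _ _ _ (fun l => 0 * nu l)); last first.
    by move=> l; rewrite nu0 mul0r.
  rewrite (mmap_homog_scale _ _ _ (homogM l0)) expr0n eqn0Ngt d_gt0 mul0r => /esym/eqP.
  by rewrite mulf_eq0 (negPf H0) (negPf tl0).
have [c [x [c0 nuE x_neq0]]] := common_factor nu_neq0.
have scale p : p \is d.-homog -> mmap (@polyC K) nu p = c ^+ d * mmap (@polyC K) x p.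
  by move=> hp; rewrite -(mmap_homog_scale _ _ _ hp); apply: eq_mmap.
(* [c ^+ d] divides [h * t l] on the line for all [l], hence [h] itself by [det_t]. *)
have /dvdpP[h' eh] : c ^+ d %| on_line b a h.
  rewrite -(dvdpZr _ _ indep) -mul_polyC -det_t mulrC mulrBr -!scalerAr -!M_nu !scale //.
  by rewrite !scalerAr -mulrBr dvdp_mulr.
have M_x l : mmap (@polyC K) x (tnth M l) = h' * t l.
  apply: (mulfI (expf_neq0 d c0)); rewrite -scale // M_nu eh; ring.
have h'0 : h' != 0 by apply: contraNneq H0 => h0; rewrite eh h0 mul0r.
have -> : on_line b a (f \mPo N) = mmap (@polyC K) x f * c ^+ d.
  by rewrite mulrC -scale // -mmap_comp_mpoly.
rewrite eh dvdp_mul2r ?expf_neq0 //; apply: dvdp_closed => // s [|m] hm.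
  by rewrite expr0 dvd1p.
(* At a root [s] of [h'] the arc meets a base point: all [h' * t l] vanish there, while the [x l] do
   not vanish together. *)
pose A l := (x l).[s].
have h's : h'.[s] = 0.
  by apply/eqP; rewrite -/(root h' s) -dvdp_XsubCl; apply: dvdp_trans hm; rewrite dvdp_exp.
have baseA : base_locus M A.
  split=> [|l]; first exact: x_neq0.
  by rewrite -horner_mmap M_x hornerM h's mul0r.
have [k Ak] := x_neq0 s.
have Mx_neq0 : exists l, mmap (@polyC K) x (tnth M l) != 0.
  by exists l0; rewrite M_x mulf_neq0.
have M_neq0 : nonzero_map M.
  by case: Mx_neq0 => l Ml; exists l; apply: contraNneq Ml => ->; rewrite mmap0.
have r_gt0 := generic_mult_gt0 F baseA M_neq0.
have red p := @transversal_reduction _ charK F d M homogM A k Ak p (transM baseA) r_gt0.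
have om l : ord_ge (mult (pointF F A) (V1 F M)) (chart k A (tnth M l)).
  exact: ord_ge_generic_chart.
have off : ord_ge (mult (pointF F A) (V1 F M)) (chart k A f).
  by apply: ord_ge_chart => // m' hm'; apply: mult_vanish; apply: leq_trans (multf baseA).
move: r_gt0 om off red; case: mult => // r _ om off red.
have red_var (i' : 'I_2) : exists q : 'I_3 -> {mpoly K[2]}, (forall l, ord_ge r (q l)) /\
    ord_ge r.+1.*2 ('X_i' ^+ r.*2.+1 - \sum_l q l * chart k A (tnth M l)).
  apply: red; rewrite -[X in ord_ge X]muln1; apply: ord_geX.
  by have := @ord_ge_mpolyX _ K U_(i')%MM; rewrite mdeg1.
have [B [hB [l hl]]] :=
  exists_arc_order Ak (fun=> erefl) homogM homogf om off red_var Mx_neq0.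
(* If [B] were at most [m], the power [B.+1] of ['X - s] would divide [h'], hence every component of
   [M] along the arc, contrary to [hl]. *)
apply: dvdp_trans hB; apply: dvdp_exp2l; rewrite leqNgt; apply: contra hl => hBm.
rewrite M_x dvdp_mulr //; apply: dvdp_trans hm; exact: dvdp_exp2l.
Qed.

End Birational.

(** Along the line [b + s a] the quotient [G / h] is [l_0 + l_1 s], and [l_1 = G(a) / h(a)]
    depends linearly on [a]: it is read off the first-order terms at [s = 0]. *)
Lemma linear_quotient (K : closedFieldType) (charK : [pchar K] =i pred0) (D : nat)
    (h G : {mpoly K[3]}) : h != 0 -> h \is D.-homog -> G \is D.+1.-homog ->
  (forall a b i j, h.@[b] != 0 -> a i * b j - a j * b i != 0 ->
    on_line b a h %| on_line b a G) ->
  exists l : 'I_3 -> K, G = h * \sum_i l i *: 'X_i.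
Proof.
move=> h0 hh hG dvd.
pose i0 : 'I_3 := ord0; pose i1 : 'I_3 := ord_max.
have [b] : exists b, (h * 'X_i0).@[b] != 0.
  apply: NNPP => no; have : h * 'X_i0 = 0.
    apply: mpoly_fun_eq0 => // b; apply/eqP/negPn/negP => hb; apply: no; by exists b.
  by move/eqP; rewrite mulf_eq0 (negPf h0) -msize_poly_eq0 msizeX.
rewrite mevalM mevalXU mulf_eq0 negb_or => /andP[hb b0].
(* Quotient rule: the gradient of [G / h] at [b]. *)
pose l i := (h.@[b] * (G^`M(i)).@[b] - G.@[b] * (h^`M(i)).@[b]) / h.@[b] ^+ 2.
exists l; set ell := \sum_i _.
pose Delta : {mpoly K[3]} := b i0 *: 'X_i1 - b i1 *: 'X_i0.
have Delta0 : Delta != 0.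
  apply: contraNneq b0 => /(congr1 (mcoeff U_(i1))).
  by rewrite mcoeffB !mcoeffZ !mcoeffXU mcoeff0 /= mulr0 subr0 mulr1 => ->.
(* The factor [h * Delta] confines the test to points [a] independent of [b] with [h(a)] nonzero. *)
suff : h * Delta * (G - h * ell) = 0.
  by move/eqP; rewrite !mulf_eq0 (negPf h0) (negPf Delta0) subr_eq0 => /eqP.
apply: mpoly_fun_eq0 => // a; rewrite !mevalM.
have [->|ha] := eqVneq h.@[a] 0; first by rewrite !mul0r.
have [->|Da] := eqVneq Delta.@[a] 0; first by rewrite mulr0 mul0r.
have /dvdpP[q Gq] : on_line b a h %| on_line b a G.
  apply: (dvd _ _ i1 i0 hb); move: Da.
  by rewrite mevalB !mevalZ !mevalXU mulrC [b i1 * _]mulrC.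
have [hsize htop] := top_coef_on_line b a hh.
have [Gsize Gtop] := top_coef_on_line b a hG.
(* On the line [G] has degree at most [D + 1], and [h] has degree exactly [D] because its top
   coefficient is [h(a)]. *)
have sq : (size q <= 2)%N.
  have H0 : on_line b a h != 0.
    by apply: contraNneq hb => e0; rewrite -(coef0_on_line b a) e0 coef0.
  have [->|q0] := eqVneq q 0; first by rewrite size_poly0.
  have : (D < size (on_line b a h))%N.
    by rewrite ltnNge; apply: contra ha => hs; rewrite -htop nth_default.
  move: Gsize; rewrite Gq size_mul //.
  have aux u v : ((u + v).-1 <= D.+2 -> D < v -> u <= 2)%N by lia.
  exact: aux.
have eG0 : G.@[b] = q`_0 * h.@[b].
  by rewrite -(coef0_on_line b a) Gq coefM big_ord1 subnn coef0_on_line.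
have eG1 : \sum_i a i * (G^`M(i)).@[b] = q`_0 * (\sum_i a i * (h^`M(i)).@[b]) + q`_1 * h.@[b].
  by rewrite -!coef1_on_line Gq coefM big_ord_recl big_ord1 /= coef0_on_line.
have eGa : G.@[a] = q`_1 * h.@[a].
  have [_] := top_coefM (conj sq (erefl q`_1)) (conj hsize htop).
  by rewrite -Gq add1n Gtop.
rewrite [(G - _).@[a]]mevalB [(h * _).@[a]]mevalM; apply/eqP; rewrite mulf_eq0 subr_eq0.
apply/orP; right; apply/eqP; rewrite eGa mulrC; congr (_ * _); apply: (mulIf (expf_neq0 2 hb)).
have -> : ell.@[a] * h.@[b] ^+ 2 =
    h.@[b] * (\sum_i a i * (G^`M(i)).@[b]) - G.@[b] * (\sum_i a i * (h^`M(i)).@[b]).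
  rewrite /ell raddf_sum big_distrl !big_distrr -sumrB /=; apply: eq_bigr => i _.
  by rewrite mevalZ mevalXU mulrAC divfK ?expf_neq0 //; ring.
rewrite eG1 eG0; ring.
Qed.

(** * The two inclusions between the linear systems *)

Theorem theorem5 (K : closedFieldType) (charK : [pchar K] =i pred0)
  (F : alg_closure {fraction {mpoly K[3 + 3]}})
  (d : nat) (M : 3.-tuple {mpoly K[3]})
  (homogM : homog_map d M) (gcdM : gcd_one M)
  (birM : birational M) (transM : transversal_map F M) :
  forall f : {mpoly K[3]}, calL M f <-> Lambda F d M f.
Proof.
have [e [N [homogN [NM_nz _ NM_eq] [MN_nz _ MN_eq]]]] := birM.
have compE P Q i : tnth (comp_map P Q) i = tnth P i \mPo Q by rewrite tnth_mktuple.
have idE i : tnth (id_map K) i = 'X_i by rewrite tnth_mktuple.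
have [g hg] : exists g, forall i, tnth N i \mPo M = g * 'X_i.
  by apply: proportional_to_vars => i j; rewrite -!compE -!idE NM_eq.
have [h hh] : exists h, forall i, tnth M i \mPo N = h * 'X_i.
  by apply: proportional_to_vars => i j; rewrite -!compE -!idE MN_eq.
have g0 : g != 0.
  have [i] := NM_nz; rewrite compE hg; apply: contraNneq => ->; by rewrite mul0r.
have h0 : h != 0.
  have [i] := MN_nz; rewrite compE hh; apply: contraNneq => ->; by rewrite mul0r.
have comp_NM p : p \is d.-homog -> (p \mPo N) \mPo M = g ^+ d * p.
  move=> hp; rewrite [LHS]mmap_comp_mpoly (@eq_mmap _ _ _ _ _ (fun i => g * 'X_i)); last first.
    by move=> i; rewrite -hg.
  rewrite (mmap_homog_scale _ _ _ hp) -[in RHS](comp_mpoly_id p); congr (_ * _).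
  by apply: eq_mmap => i; rewrite tnth_mktuple.
have [i0 Mi0] : exists i, tnth M i != 0.
  have [i] := MN_nz; rewrite compE => Mi; exists i.
  by apply: contraNneq Mi => ->; rewrite comp_mpoly0.
(* Composing [m_i(N) = h t_i] with [M] gives [g^d m_i = h(M) m_i]. *)
have hM : h \mPo M = g ^+ d.
  apply: (mulIf Mi0); rewrite -(comp_NM _ (homogM i0)) hh rmorphM /=; congr (_ * _).
  by rewrite [RHS]mmapX mmap1U.
have lin_comp (a : 'I_3 -> K) (p : {mpoly K[3]}) :
    p \is d.-homog -> p \mPo N = h * \sum_i a i *: 'X_i -> p = \sum_i a i *: tnth M i.
  move=> hp /(congr1 (comp_mpoly M)); rewrite comp_NM // rmorphM /= hM.
  move/(mulfI (expf_neq0 d g0)) ->; rewrite raddf_sum; apply: eq_bigr => i _ /=.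
  by rewrite comp_mpolyZ [X in _ *: X]mmapX mmap1U.
have [D eD hhomog] : exists2 D, (d * e)%N = D.+1 & h \is D.-homog.
  by apply: homog_mulX h0; rewrite -hh; apply: dhomog_comp_mpoly (homogM i0) homogN.
move=> f; split.
  move=> [a [[j aj] ef]].
  have hf : f \is d.-homog.
    by rewrite ef; apply: rpred_sum => i _; apply/dhomogZ/homogM.
  (* The components are linearly independent: composition with [N] turns the combination into [h]
     times a nonzero linear form. *)
  have f0 : f != 0.
    have fN : f \mPo N = h * \sum_i a i *: 'X_i.
      rewrite ef raddf_sum big_distrr; apply: eq_bigr => i _ /=.
      by rewrite comp_mpolyZ hh scalerAr.
    apply: contraNneq aj => f0; move: fN; rewrite f0 comp_mpoly0 => /esym.
    move/eqP; rewrite mulf_eq0 (negPf h0) /= => /eqP/(congr1 (mcoeff U_(j))).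
    rewrite mcoeff0 raddf_sum (bigD1 j) //= mcoeffZ mcoeffXU eqxx mulr1 big1 ?addr0 => [->|i ij] //.
    by rewrite mcoeffZ mcoeffXU (negPf ij) mulr0.
  split=> // A baseA; exists (mult (pointF F A) (V1 F M) ^ 2)%N; first exact: transM.
  rewrite natrX sqrCK ?ler0n // ler_nat.
  have [->//|r_gt0] := posnP (mult (pointF F A) (V1 F M)).
  apply: mult_ge => [|m hm]; last first.
    rewrite ef raddf_sum raddf_sum big1 // => i _ /=.
    by rewrite mderivmZ mevalZ (generic_mult_vanish _ hm) mulr0.
  (* The range of [mult] for [f] reaches [d], and the multiplicity of [V1] is below
     [msize (V1 F M)], at most [d + 1]. *)
  rewrite (msize_homog hf f0); apply: leq_trans (mult_lt_msize r_gt0) _.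
  have [->|V0] := eqVneq (V1 F M) 0; first by rewrite msize0.
  by rewrite (msize_homog (generic_member_homog F homogM _) V0).
move=> [[f0 hf] multf].
(* From [r ^ 2 <= n] and [sqrt n <= mult A f] follows [r <= mult A f]. *)
have multf' A : base_locus M A -> (mult (pointF F A) (V1 F M) <= mult A f)%N.
  move=> baseA; have [n hn hle] := multf A baseA.
  rewrite -(ler_nat algC); apply: Order.POrderTheory.le_trans hle.
  have [[k Ak] _] := baseA; have [hn2 _] := base_mult_ge charK homogM Ak hn.
  rewrite -[X in X <= _]sqrCK ?ler0n //.
  by rewrite ler_sqrtC ?qualifE /= ?exprn_ge0 ?ler0n // -natrX ler_nat.
have [|a b i j hb indep|l efN] := linear_quotient charK (G := f \mPo N) h0 hhomog.
- by rewrite -eD; apply: dhomog_comp_mpoly.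
- exact: (dvdp_on_line charK homogM transM homogN hh hf multf' hb indep).
have ef := lin_comp l f hf efN; exists l; split=> //.
have [/existsP|/existsPn l0] := boolP [exists i, l i != 0]; first by [].
case/negP: f0; rewrite ef big1 // => i _; have := l0 i; rewrite negbK => /eqP ->.
by rewrite scale0r.
Qed.
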